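(* Consider $a,b\in\mathbb R^n_+$ and $P=\{x\mid x\ge0,\ 1-a^\top x\ge0,\ 1-b^\top x\ge0\}$. Let $N^>=\{i\mid a_i>b_i\}$, $N^<=\{i\mid a_i<b_i\}$, $N^{=}=\{i\mid a_i=b_i\}$, and $$d(x)=1-\sum_{j\in N^<}a_jx_j-\sum_{j\in N^>}b_jx_j-\sum_{j\in N^=}a_jx_j.$$ Then, after the DD algorithm (defined in the context) has processed all the rows in the listed order, the barycentric coordinates (at $x_0=1$) are as follows, where the argument of $\mu$ is the corresponding ray: $$\mu(a_ie_0+e_i)=x_i\quad (i\in N^=),$$ $$\mu(e_0)=(1-a^\top x)(1-b^\top x)/d(x),$$ $$\mu(a_ie_0+e_i)=x_i(1-b^\top x)/d(x)\quad(i\in N^>),$$ $$\mu(b_ie_0+e_i)=x_i(1-a^\top x)/d(x)\quad(i\in N^<),$$ $$\mu\bigl((a_ib_j-a_jb_i)e_0+(b_j-a_j)e_i+(a_i-b_i)e_j\bigr)=x_ix_j/d(x)\quad(i\in N^>,\ j\in N^<).$$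
   Context: $P$ is homogenized with a variable $x_0$ (so the inequalities become $x\ge0$, $x_0-a^\top x\ge0$, $x_0-b^\top x\ge0$, together with $x_0\ge0$); coordinates of $\mathbb R^{n+1}$ are indexed $0,\dots,n$ with unit vectors $e_0,\dots,e_n$. DD algorithm. After processing $x_0\ge0$ and $x\ge0$, the ray matrix is $R^0=I_{n+1}$ with coordinates $\mu^0=(x_0;x)$ (no lineality directions). For each subsequent inequality $\bar A_{k,:}(x_0;x)\ge0$ (first $k=1$: $x_0-a^\top x\ge0$; then $k=2$: $x_0-b^\top x\ge0$): with $R=R^{k-1}$, $\mu=\mu^{k-1}$, set $\beta=\bar A_{k,:}R$, let $N^-,N^0,N^+$ be the sets of column indices $i$ with $\beta_i<0$, $=0$, $>0$, and $N_{\rm tot}=\sum_{i\in N^+}\mu_i\beta_i$. Then $\mu^k=\bigl(\mu_{N^0},(\mu_i+\sum_{j\in N^-}\mu_j\mu_i\beta_j/N_{\rm tot})_{i\in N^+},(\mu_j\mu_i/N_{\rm tot})_{i\in N^+,j\in N^-}\bigr)$ and $R^k=\bigl(R_{:,N^0},R_{:,N^+},(\beta_iR_{:,j}-\beta_jR_{:,i})_{i\in N^+,j\in N^-}\bigr)$. The columns of $R^k$ are the rays and the corresponding entries of $\mu^k$ are their barycentric coordinates. *)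

(* Defs.v *)
From HB Require Import structures.
From mathcomp Require Import all_boot all_order all_algebra.

Set Implicit Arguments.
Unset Strict Implicit.
Unset Printing Implicit Defensive.

Import Order.TTheory GRing.Theory Num.Theory.

Local Open Scope ring_scope.

Section DoubleDescription.
Variable R : realFieldType.

(* A ray matrix R^k together with mu^k, stored column by column: an entry is a
   pair (column of R^k, corresponding entry of mu^k). *)
Definition dd_state (m : nat) := seq ('cV[R]_m * R).

Definition rays m (s : dd_state m) : seq 'cV[R]_m := [seq c.1 | c <- s].

(* The entry of mu attached to the ray r. It is meaningful only when r occurs
   exactly once among the rays of s; it is 0 if r does not occur. *)
Definition mu m (s : dd_state m) (r : 'cV[R]_m) : R :=
  (nth (0, 0) s (index r (rays s))).2.

Definition dd_step m (s : dd_state m) (A : 'rV[R]_m) : dd_state m :=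
  let beta (c : 'cV[R]_m * R) : R := (A *m c.1) 0 0 in
  let Nneg := [seq c <- s | beta c < 0] in
  let Nzero := [seq c <- s | beta c == 0] in
  let Npos := [seq c <- s | 0 < beta c] in
  let Ntot := \sum_(c <- Npos) c.2 * beta c in
  Nzero
  ++ [seq (i.1, i.2 + \sum_(j <- Nneg) j.2 * i.2 * beta j / Ntot) | i <- Npos]
  ++ [seq (beta i *: j.1 - beta j *: i.1, j.2 * i.2 / Ntot)
       | i <- Npos, j <- Nneg].

Section Instance.
Variable n : nat.
Implicit Types a b x : 'cV[R]_n.

Definition dot a x : R := (a^T *m x) 0 0.

(* Coordinate 0 of R^(n+1) is the homogenizing one; coordinate i : 'I_n of R^n
   becomes coordinate [lift ord0 i]. *)
Definition e0 : 'cV[R]_n.+1 := delta_mx ord0 0.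
Definition e_ (i : 'I_n) : 'cV[R]_n.+1 := delta_mx (lift ord0 i) 0.

Definition homog (x0 : R) x : 'cV[R]_n.+1 := col_mx (const_mx x0 : 'cV_1) x.

(* The coefficient row of x_0 - a^T x >= 0. *)
Definition ineq_row a : 'rV[R]_n.+1 := row_mx (const_mx 1 : 'rV_1) (- a^T).

(* R^0 = I_(n+1) and mu^0 = (x_0; x). *)
Definition dd_init (x0 : R) x : dd_state n.+1 :=
  [seq (col i 1%:M, homog x0 x i 0) | i <- enum 'I_n.+1].

Definition dd_run a b (x0 : R) x : dd_state n.+1 :=
  foldl (@dd_step n.+1) (dd_init x0 x) [:: ineq_row a; ineq_row b].

Definition inP a b x : Prop :=
  [/\ forall i, 0 <= x i 0, 0 <= 1 - dot a x & 0 <= 1 - dot b x].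

Definition Ngt a b : {set 'I_n} := [set i | b i 0 < a i 0].
Definition Nlt a b : {set 'I_n} := [set i | a i 0 < b i 0].
Definition Neq a b : {set 'I_n} := [set i | a i 0 == b i 0].

(* d may vanish at degenerate points of P. There division by d (and by Ntot,
   which equals d in the second step) returns 0, which is also the limit at such
   a point, taken within the points of P where d <> 0, of every coordinate whose
   formula has the denominator d. *)
Definition d a b x : R :=
  1 - \sum_(j in Nlt a b) a j 0 * x j 0
    - \sum_(j in Ngt a b) b j 0 * x j 0
    - \sum_(j in Neq a b) a j 0 * x j 0.

Definition pair_ray a b (i j : 'I_n) : 'cV[R]_n.+1 :=
  (a i 0 * b j 0 - a j 0 * b i 0) *: e0
  + (b j 0 - a j 0) *: e_ i + (a i 0 - b i 0) *: e_ j.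

Definition listed_rays a b : seq 'cV[R]_n.+1 :=
  e0
  :: [seq a i 0 *: e0 + e_ i | i <- enum (Neq a b)]
  ++ [seq a i 0 *: e0 + e_ i | i <- enum (Ngt a b)]
  ++ [seq b i 0 *: e0 + e_ i | i <- enum (Nlt a b)]
  ++ [seq pair_ray a b i j | i <- enum (Ngt a b), j <- enum (Nlt a b)].

End Instance.
End DoubleDescription.

Arguments e0 {R n}.
Arguments e_ {R n} i.

(* Main.v *)
Require Import Defs.
From HB Require Import structures.
From mathcomp Require Import all_boot all_order all_algebra.
From mathcomp Require Import ring.

Set Implicit Arguments.
Unset Strict Implicit.
Unset Printing Implicit Defensive.

Import Order.TTheory GRing.Theory Num.Theory.

Local Open Scope ring_scope.

(** One step of the double description method commutes with permutations of
the columns ([perm_dd_step]), so a state only matters up to permutation.  Let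
[apex_state c x] consist of the entries (e_0, 1 - c^T x) and
(c_i e_0 + e_i, x_i) for all i: its rays are those of the simplicial cone cut
out by x >= 0 and x_0 - c^T x >= 0.  The initial state is [apex_state 0 x].

When the row x_0 - b^T x >= 0 is processed from [apex_state c x], the value of
beta is 1 at e_0 and c_i - b_i at c_i e_0 + e_i.  So N^0, N^+ and N^- consist
of the indices in N^=, of e_0 together with N^>, and of N^<, and N_tot equals
d.  The resulting state [cut_state c b x] has exactly the entries to be
established, for c in place of a ([dd_step_apex]).

This computation covers both steps.  With c = 0 and b = a >= 0 the set N^> is
empty, d = 1, and the new state is a permutation of [apex_state a x]
([cut_state0]); with c = a it yields the final state.  At a point of P with
d = 0 the formulas survive because d is a sum of the nonnegative terms
1 - c^T x and x_i (c_i - b_i) for i in N^>: these all vanish, so the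
coordinates indexed by N^+ are 0 before and after the step.

Finally, the rays are pairwise distinct, because their supports among the
coordinates 1, ..., n are the empty set, the singletons {i}, and the pairs
{i, j} with i in N^> and j in N^< ([listed_rays_uniq]); hence [mu] reads off
the entry of each ray. *)

(** * Generalities on states *)

Section States.
Variables (R : realFieldType) (m : nat).
Implicit Types (s t : dd_state R m) (A : 'rV[R]_m).

Lemma perm_dd_step s t A : perm_eq s t -> perm_eq (dd_step s A) (dd_step t A).
Proof.
move=> st; rewrite /dd_step.
set beta := fun c : 'cV[R]_m * R => (A *m c.1) 0 0.
have stp := perm_filter (fun c => 0 < beta c) st.
have stn := perm_filter (fun c => beta c < 0) st.
have stz := perm_filter (fun c => beta c == 0) st.
rewrite (perm_big _ stp) /=.
apply: perm_cat => //; apply: perm_cat; last exact: perm_allpairs.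
under eq_map => i do rewrite (perm_big _ stn) /=.
exact: perm_map.
Qed.

Lemma mu_uniq s r v : uniq (rays s) -> (r, v) \in s -> mu s r = v.
Proof.
rewrite /mu; elim: s => //= -[r' v'] s IHs /andP[r's us].
rewrite inE => /predU1P[[-> ->]|rvs]; first by rewrite eqxx.
have rs : r \in rays s by apply/mapP; exists (r, v).
by case: eqVneq => [r'r|_]; [rewrite r'r rs in r's | exact: IHs].
Qed.

End States.

(** * Cutting the cone of one inequality by another *)

Section Cut.
Variables (R : realFieldType) (n : nat).
Implicit Types (a b c x : 'cV[R]_n) (i j : 'I_n).

(** The ray on which the inequality with coefficient vector [c] is tight and
whose only nonzero coordinate among 1, ..., n is that of [i]. *)
Definition edge_ray c i : 'cV[R]_n.+1 := c i 0 *: e0 + e_ i.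

(** The rays of the cone x >= 0, x_0 - c^T x >= 0, with the barycentric
coordinates of (1; x) on them. *)
Definition apex_state c x : dd_state R n.+1 :=
  (e0, 1 - dot c x) :: [seq (edge_ray c i, x i 0) | i <- enum 'I_n].

(** The state obtained from [apex_state c x] by processing the row
x_0 - b^T x >= 0.  Its three blocks are the columns coming from N^0, from N^+
(where e_0 comes first), and from N^+ x N^-; in the last block the pairs whose
first member is e_0 come first. *)
Definition cut_state c b x : dd_state R n.+1 :=
  [seq (edge_ray c i, x i 0) | i <- enum (Neq c b)]
  ++ ((e0, (1 - dot c x) * (1 - dot b x) / d c b x)
      :: [seq (edge_ray c i, x i 0 * (1 - dot b x) / d c b x)
           | i <- enum (Ngt c b)])
  ++ ([seq (edge_ray b j, x j 0 * (1 - dot c x) / d c b x)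
        | j <- enum (Nlt c b)]
      ++ [seq (pair_ray c b i j, x i 0 * x j 0 / d c b x)
           | i <- enum (Ngt c b), j <- enum (Nlt c b)]).

Lemma dotE c x : dot c x = \sum_i c i 0 * x i 0.
Proof. by rewrite /dot mxE; apply: eq_bigr => i _; rewrite mxE. Qed.

Lemma dot0 x : dot 0 x = 0.
Proof. by rewrite dotE big1 // => i _; rewrite mxE mul0r. Qed.

Lemma ineq_row_e0 b : (ineq_row b *m e0) 0 0 = 1.
Proof.
rewrite /e0 -colE mxE /ineq_row.
have -> : ord0 = lshift n (0 : 'I_1) by exact/val_inj.
by rewrite (@row_mxEl _ 1 1 n) mxE.
Qed.

Lemma ineq_row_e_ b i : (ineq_row b *m e_ i) 0 0 = - b i 0.
Proof.
rewrite /e_ -colE mxE /ineq_row.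
have -> : lift ord0 i = rshift 1 i by exact/val_inj.
by rewrite (@row_mxEr _ 1 1 n) !mxE.
Qed.

Lemma ineq_row_edge b c i : (ineq_row b *m edge_ray c i) 0 0 = c i 0 - b i 0.
Proof.
by rewrite mulmxDr -scalemxAr mxE [X in X + _]mxE ineq_row_e0 ineq_row_e_ mulr1.
Qed.

Lemma dd_initE x : dd_init 1 x = apex_state 0 x.
Proof.
rewrite /dd_init /apex_state enum_ordSl /= dot0 subr0; congr (_ :: _).
  congr pair; first by apply/colP=> k; rewrite !mxE eqxx andbT.
  rewrite /homog; have -> : ord0 = lshift n (0 : 'I_1) by exact/val_inj.
  by rewrite (@col_mxEu _ 1 n 1) mxE.
rewrite -map_comp; apply: eq_map => i /=; congr pair.
  by apply/colP=> k; rewrite !mxE mul0r add0r eqxx andbT.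
rewrite /homog; have -> : lift ord0 i = rshift 1 i by exact/val_inj.
by rewrite (@col_mxEd _ 1 n 1).
Qed.

Lemma sum_trichotomy c b (F : 'I_n -> R) :
  \sum_i F i = \sum_(i in Nlt c b) F i + \sum_(i in Ngt c b) F i
               + \sum_(i in Neq c b) F i.
Proof.
rewrite (bigID [in Nlt c b]) /= -addrA; congr (_ + _).
rewrite (bigID [in Ngt c b]) /=.
by congr (_ + _); apply: eq_bigl => i; rewrite !inE; case: ltgtP.
Qed.

(** The right-hand side is N_tot, the total over e_0 and N^>. *)
Lemma d_Ngt c b x :
  d c b x = 1 - dot c x + \sum_(i in Ngt c b) x i 0 * (c i 0 - b i 0).
Proof.
rewrite /d dotE (sum_trichotomy c b).
have -> : \sum_(i in Ngt c b) x i 0 * (c i 0 - b i 0) =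
    \sum_(i in Ngt c b) c i 0 * x i 0 - \sum_(i in Ngt c b) b i 0 * x i 0.
  by rewrite -sumrB; apply: eq_bigr => i _; rewrite mulrBr ![x i 0 * _]mulrC.
ring.
Qed.

Lemma d_Nlt c b x :
  1 - dot b x = d c b x + \sum_(j in Nlt c b) x j 0 * (c j 0 - b j 0).
Proof.
rewrite /d dotE (sum_trichotomy c b).
have -> : \sum_(j in Nlt c b) x j 0 * (c j 0 - b j 0) =
    \sum_(j in Nlt c b) c j 0 * x j 0 - \sum_(j in Nlt c b) b j 0 * x j 0.
  by rewrite -sumrB; apply: eq_bigr => i _; rewrite mulrBr ![x i 0 * _]mulrC.
have -> : \sum_(j in Neq c b) b j 0 * x j 0 = \sum_(j in Neq c b) c j 0 * x j 0.
  by apply: eq_bigr => i; rewrite inE => /eqP ->.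
ring.
Qed.

(** At a point of P where d = 0, every coordinate indexed by N^+ vanishes. *)
Lemma inP_d0 c b x : inP c b x -> d c b x = 0 ->
  1 - dot c x = 0 /\ {in Ngt c b, forall i, x i 0 = 0}.
Proof.
move=> [x_ge0 cx_ge0 _]; rewrite d_Ngt => d0.
have t_ge0 i : i \in Ngt c b -> 0 <= x i 0 * (c i 0 - b i 0).
  by rewrite inE => lt_bc; rewrite mulr_ge0 // subr_ge0 ltW.
have [-> s0] : 1 - dot c x = 0
    /\ \sum_(i in Ngt c b) x i 0 * (c i 0 - b i 0) = 0.
  have s_ge0 := sumr_ge0 _ t_ge0.
  by move/eqP: d0; rewrite paddr_eq0 // => /andP[/eqP-> /eqP->].
split=> // i iN; move: (iN); rewrite inE -subr_gt0 => /lt0r_neq0 cb.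
have/eqP := psumr_eq0P t_ge0 s0 iN.
by rewrite mulf_eq0 (negbTE cb) orbF => /eqP.
Qed.

(** The update of a coordinate [v] indexed by N^+; the second alternative
covers the points of P where d = 0. *)
Lemma pos_update c b x v : d c b x != 0 \/ v = 0 ->
  v + \sum_(j in Nlt c b) x j 0 * v * (c j 0 - b j 0) / d c b x
  = v * (1 - dot b x) / d c b x.
Proof.
case=> [d_neq0|->]; last first.
  by rewrite big1 ?addr0 ?mul0r// => j _; rewrite mulr0 !mul0r.
rewrite (d_Nlt c b) mulrDr mulrDl mulfK //; congr (_ + _).
rewrite mulr_sumr mulr_suml; apply: eq_bigr => j _.
by rewrite mulrCA mulrA.
Qed.

Lemma edge_combine_e0 c b j :
  1 *: edge_ray c j - (c j 0 - b j 0) *: e0 = edge_ray b j.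
Proof. by apply/colP=> k; rewrite !mxE; ring. Qed.

Lemma edge_combine c b i j :
  (c i 0 - b i 0) *: edge_ray c j - (c j 0 - b j 0) *: edge_ray c i
  = pair_ray c b i j.
Proof. by apply/colP=> k; rewrite !mxE; ring. Qed.

Lemma dd_step_apex c b x : inP c b x \/ d c b x != 0 ->
  dd_step (apex_state c x) (ineq_row b) = cut_state c b x.
Proof.
move=> hx; rewrite /dd_step /apex_state.
set f := fun i => (edge_ray c i, x i 0).
have filterE (A : {set 'I_n}) (p : pred ('cV[R]_n.+1 * R)) :
    (forall i, p (f i) = (i \in A)) ->
    [seq v <- [seq f i | i <- enum 'I_n] | p v] = [seq f i | i <- enum A].
  by move=> pA; rewrite filter_map (eq_filter pA) enumT.
set E := map f _ in filterE *; rewrite /= ineq_row_e0 oner_eq0 ltr01 ltr10.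
rewrite (filterE (Neq c b)) => [|i]; last by rewrite ineq_row_edge inE subr_eq0.
rewrite (filterE (Nlt c b)) => [|i]; last by rewrite ineq_row_edge inE subr_lt0.
rewrite (filterE (Ngt c b)) => [|i]; last by rewrite ineq_row_edge inE subr_gt0.
have -> : \sum_(v <- (e0, 1 - dot c x) :: [seq f i | i <- enum (Ngt c b)])
            v.2 * (ineq_row b *m v.1) 0 0 = d c b x.
  rewrite big_cons big_map big_enum /= ineq_row_e0 mulr1 d_Ngt.
  by under eq_bigr => i _ do rewrite ineq_row_edge.
have posE v : d c b x != 0 \/ v = 0 ->
    v + \sum_(j <- [seq f j | j <- enum (Nlt c b)])
          j.2 * v * (ineq_row b *m j.1) 0 0 / d c b x
    = v * (1 - dot b x) / d c b x.
  move=> hv; rewrite big_map big_enum -pos_update //=.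
  by under eq_bigr => j _ do rewrite ineq_row_edge.
have [c0 N0] : (d c b x != 0 \/ 1 - dot c x = 0)
    /\ {in Ngt c b, forall i, d c b x != 0 \/ x i 0 = 0}.
  case: eqVneq hx => [d0 [hx|//]|_ _]; last by split=> [|i _]; left.
  by have [-> x0] := inP_d0 hx d0; split=> [|i iN]; right=> //; exact: x0.
rewrite /cut_state /= posE //; congr (_ ++ (_ :: _ ++ _)).
  rewrite -map_comp; apply/eq_in_map => i; rewrite mem_enum => iN /=.
  by rewrite posE //; exact: N0.
congr (_ ++ _).
  rewrite -map_comp; apply: eq_map => j /=.
  by rewrite ineq_row_e0 ineq_row_edge edge_combine_e0.
rewrite allpairs_mapl allpairs_mapr; apply: eq_allpairs => i j /=.
by rewrite !ineq_row_edge edge_combine [x j 0 * _]mulrC.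
Qed.

Lemma rays_cut_state c b x : perm_eq (rays (cut_state c b x)) (listed_rays c b).
Proof.
rewrite /rays /cut_state !map_cat /= !map_allpairs -!map_comp /listed_rays.
by rewrite -cat1s perm_catCA /= catA.
Qed.

Lemma Ngt0 b : (forall i, 0 <= b i 0) -> Ngt 0 b = set0.
Proof. by move=> b_ge0; apply/setP=> i; rewrite !inE mxE ltNge b_ge0. Qed.

Lemma d0E b x : (forall i, 0 <= b i 0) -> d 0 b x = 1.
Proof. by move=> b_ge0; rewrite d_Ngt dot0 subr0 Ngt0 // big_set0 addr0. Qed.

Lemma cut_state0 b x : (forall i, 0 <= b i 0) ->
  perm_eq (cut_state 0 b x) (apex_state b x).
Proof.
move=> b_ge0; have N0 := Ngt0 b_ge0.
rewrite /cut_state N0 enum_set0 /= d0E // dot0 !subr0 mul1r divr1 cats0.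
rewrite -cat1s perm_catCA /= perm_cons.
under [X in _ ++ X]eq_map => j do rewrite mulr1 divr1.
have -> : [seq (edge_ray 0 i, x i 0) | i <- enum (Neq 0 b)]
    = [seq (edge_ray b i, x i 0) | i <- enum (Neq 0 b)].
  apply/eq_in_map => i; rewrite mem_enum inE => /eqP bi.
  by rewrite /edge_ray bi.
rewrite -map_cat perm_map //; apply: uniq_perm; rewrite ?enum_uniq //.
  rewrite cat_uniq !enum_uniq andbT /=; apply/hasPn=> i.
  by rewrite !mem_enum !inE => /lt_eqF; rewrite eq_sym => ->.
move=> i; rewrite mem_cat !mem_enum !inE !mxE.
by rewrite -le_eqVlt b_ge0.
Qed.

(** * Distinctness of the rays *)

(** The indices, among 1, ..., n, of the nonzero coordinates of a ray. *)
Definition ray_supp (r : 'cV[R]_n.+1) : {set 'I_n} :=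
  [set k | r (lift ord0 k) 0 != 0].

Lemma ray_supp_e0 : ray_supp e0 = set0.
Proof. by apply/setP=> k; rewrite !inE mxE /= eqxx. Qed.

Lemma ray_supp_edge c i : ray_supp (edge_ray c i) = [set i].
Proof.
apply/setP=> k; rewrite !inE !mxE /= mulr0 add0r andbT (inj_eq lift_inj).
by case: (k == i); rewrite ?oner_eq0 ?eqxx.
Qed.

Lemma ray_supp_pair c b i j : i \in Ngt c b -> j \in Nlt c b ->
  ray_supp (pair_ray c b i j) = [set i; j].
Proof.
rewrite !inE => bc cb; have nij : i != j.
  by apply: contraTneq cb => <-; rewrite -leNgt ltW.
apply/setP=> k; rewrite !inE !mxE /= mulr0 add0r !andbT !(inj_eq lift_inj).
case: (eqVneq k i) => [->|_].
  by rewrite (negbTE nij) mulr0 addr0 mulr1 gt_eqF // subr_gt0.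
case: (k == j) => /=; last by rewrite !mulr0 addr0 eqxx.
by rewrite mulr0 add0r mulr1 gt_eqF // subr_gt0.
Qed.

Lemma listed_rays_uniq c b : uniq (listed_rays c b).
Proof.
apply: (@map_uniq _ _ ray_supp).
set N1 := enum (Neq c b) ++ enum (Ngt c b) ++ enum (Nlt c b).
set P := [seq [set i; j] | i <- enum (Ngt c b), j <- enum (Nlt c b)].
have -> : [seq ray_supp r | r <- listed_rays c b]
    = (set0 : {set 'I_n}) :: [seq [set i] | i <- N1] ++ P.
  rewrite /listed_rays /= ray_supp_e0 !map_cat -!map_comp map_allpairs -!catA.
  congr (_ :: _ ++ (_ ++ (_ ++ _)));
    try by apply: eq_map => i; exact: ray_supp_edge.
  apply/eq_in_allpairs => i j; rewrite !mem_enum; exact: ray_supp_pair.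
have NgtNlt i : i \in Ngt c b -> i \in Nlt c b -> False.
  by rewrite !inE => /lt_trans h /h; rewrite ltxx.
have card1 A : A \in [seq [set i] | i <- N1] -> #|A| = 1%N.
  by case/mapP=> i _ ->; rewrite cards1.
have card2 A : A \in P -> #|A| = 2%N.
  case/allpairsP=> -[i j] /= [iN jN ->]; rewrite !mem_enum in iN jN.
  rewrite cards2; case: eqVneq => // ij.
  by case: (NgtNlt i) => //; rewrite ij.
rewrite /= cat_uniq mem_cat; apply/and4P; split.
- by apply/orP; case=> [/card1|/card2]; rewrite cards0.
- rewrite map_inj_uniq; last exact: set1_inj.
  rewrite !cat_uniq !enum_uniq /= andbT; apply/andP; split; apply/hasPn=> i.
    by rewrite mem_cat !mem_enum !inE; case: ltgtP.
  by rewrite !mem_enum !inE; case: ltgtP.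
- by apply/hasPn=> A /card2 A2; apply/negP=> /card1; rewrite A2.
apply: allpairs_uniq; rewrite ?enum_uniq // => u v.
case/allpairsP=> -[i j] /= [iN jN ->].
case/allpairsP=> -[i' j'] /= [iN' jN' ->] /= eqij.
have -> : i = i'.
  have: i \in [set i'; j'] by rewrite -eqij set21.
  rewrite mem_enum in iN; rewrite mem_enum in jN'.
  by case/set2P=> // ij; case: (NgtNlt i); rewrite // ij.
have -> // : j = j'.
have: j \in [set i'; j'] by rewrite -eqij set22.
rewrite mem_enum in jN; rewrite mem_enum in iN'.
by case/set2P=> // ji; case: (NgtNlt j); rewrite // ji.
Qed.

(** * The final state *)

Lemma perm_dd_run a b x : (forall i, 0 <= a i 0) ->
  inP a b x \/ d a b x != 0 -> perm_eq (dd_run a b 1 x) (cut_state a b x).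
Proof.
move=> a_ge0 hx; rewrite /dd_run /= dd_initE -dd_step_apex //.
apply: perm_dd_step; rewrite dd_step_apex; first exact: cut_state0.
by right; rewrite d0E // oner_eq0.
Qed.

End Cut.

Theorem proposition7 (R : realFieldType) (n : nat) (a b x : 'cV[R]_n)
    (ha : forall i, 0 <= a i 0) (hb : forall i, 0 <= b i 0)
    (hx : inP a b x \/ d a b x != 0) :
  let s := dd_run a b 1 x in
  (uniq (rays s) /\ perm_eq (rays s) (listed_rays a b)) /\
  [/\ forall i, i \in Neq a b -> mu s (a i 0 *: e0 + e_ i) = x i 0,
      mu s e0 = (1 - dot a x) * (1 - dot b x) / d a b x,
      forall i, i \in Ngt a b ->
        mu s (a i 0 *: e0 + e_ i) = x i 0 * (1 - dot b x) / d a b x,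
      forall i, i \in Nlt a b ->
        mu s (b i 0 *: e0 + e_ i) = x i 0 * (1 - dot a x) / d a b x
    & forall i j, i \in Ngt a b -> j \in Nlt a b ->
        mu s ((a i 0 * b j 0 - a j 0 * b i 0) *: e0
              + (b j 0 - a j 0) *: e_ i + (a i 0 - b i 0) *: e_ j)
        = x i 0 * x j 0 / d a b x].
Proof.
move=> s; have s_cut : perm_eq s (cut_state a b x) by exact: perm_dd_run.
have rays_s : perm_eq (rays s) (listed_rays a b).
  exact: perm_trans (perm_map _ s_cut) (rays_cut_state a b x).
have us : uniq (rays s) by rewrite (perm_uniq rays_s) listed_rays_uniq.
have muE r v : (r, v) \in cut_state a b x -> mu s r = v.
  by rewrite -(perm_mem s_cut); exact: mu_uniq.
split; first by split.
split=> [i iN||i iN|i iN|i j iN jN]; apply: muE;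
  rewrite /cut_state !mem_cat inE.
- by rewrite map_f ?mem_enum.
- by rewrite eqxx !orbT.
- by rewrite (map_f (fun i => (edge_ray a i, _))) ?mem_enum ?orbT.
- by rewrite (map_f (fun i => (edge_ray b i, _))) ?mem_enum ?orbT.
- pose f i j := (pair_ray a b i j, x i 0 * x j 0 / d a b x).
  by rewrite (allpairs_f f) ?mem_enum ?orbT.
Qed.
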